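(* Let $A_0B_0C_0$ be a triangle, $P$ a fixed point, and $\{A_kB_kC_k\}_{k\ge 0}$ a chain of Miquel triangles with Miquel point $P$, all nondegenerate and with $P$ on none of their side lines. Then: (a) If $P$ is the first Brocard point of $A_0B_0C_0$, then $P$ is the first Brocard point of every $A_kB_kC_k$ and $A_0B_0C_0\sim A_kB_kC_k$ for all $k\ge 1$. (b) If $P$ is the second Brocard point of $A_0B_0C_0$, then $P$ is the second Brocard point of every $A_kB_kC_k$ and $A_0B_0C_0\sim A_kB_kC_k$ for all $k\ge 1$. (c) If $P$ is the circumcenter of $A_0B_0C_0$ or one of the points $S_{A_0},S_{B_0},S_{C_0}$, then $A_0B_0C_0\sim A_kB_kC_k$ for every $k\equiv 0\pmod 3$ and every $k\equiv 1\pmod 3$. (d) If $P$ is the orthocenter of $A_0B_0C_0$ or one of the points $M_{A_0},M_{B_0},M_{C_0}$, then $A_0B_0C_0\sim A_kB_kC_k$ for every $k\equiv 2\pmod 3$ and every $k\equiv 0\pmod 3$.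
   Context: Miquel triangle: given a triangle $ABC$ and a point $P$ not on the lines $BC,CA,AB$, a triangle $XYZ$ with $X$ on line $BC$, $Y$ on line $CA$, $Z$ on line $AB$ is a Miquel triangle of $P$ relative to $ABC$ if $P$ lies on the circles through $A,Y,Z$, through $B,Z,X$, and through $C,X,Y$. Chain: for each $k\ge 0$, $A_{k+1}\in$ line $B_kC_k$, $B_{k+1}\in$ line $C_kA_k$, $C_{k+1}\in$ line $A_kB_k$, and $A_{k+1}B_{k+1}C_{k+1}$ is a Miquel triangle of $P$ relative to $A_kB_kC_k$. ''$\sim$'' means similarity of triangles (as unlabeled triangles). First Brocard point of $ABC$: point $P$ with $\angle BAP=\angle CBP=\angle ACP$; second: $\angle PAC=\angle PBA=\angle PCB$. With $O$ the circumcenter of $ABC$: $S_A$ is the point where the ray from $A$ along the symmedian from $A$ (reflection of the median in the angle bisector) meets the arc $BC$ of the circle through $B,C,O$ containing $O$; $S_B,S_C$ analogously. $M_A$ (for $\angle A\ne 90^\circ$, $E$ the midpoint of $BC$): if $\angle A<90^\circ$, with $F$ the second intersection of line $AE$ with the circumcircle of $ABC$, $M_A$ is the point on segment $AE$ with $EM_A=EF$; if $\angle A>90^\circ$, with $F$ such that $ABFC$ is a parallelogram, $M_A$ is the second intersection of line $AE$ with the circumcircle of $FBC$; $M_B,M_C$ analogously. *)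

(* Defs.v *)
From Stdlib Require Import Reals Lra.
Open Scope R_scope.

Definition point : Type := (R * R)%type.

Definition px (p : point) : R := fst p.
Definition py (p : point) : R := snd p.

Definition dot (u v : point) : R := px u * px v + py u * py v.
Definition vsub (u v : point) : point := (px u - px v, py u - py v).
Definition vadd (u v : point) : point := (px u + px v, py u + py v).
Definition vscale (t : R) (u : point) : point := (t * px u, t * py u).
Definition norm (u : point) : R := sqrt (dot u u).
Definition dist (p q : point) : R := norm (vsub p q).
Definition midpoint (p q : point) : point := vscale (1/2) (vadd p q).

Definition cross (u v : point) : R := px u * py v - py u * px v.
Definition orient (a b c : point) : R := cross (vsub b a) (vsub c a).

Definition collinear (a b c : point) : Prop := orient a b c = 0.
Definition nondeg (a b c : point) : Prop := ~ collinear a b c.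

Definition on_line (x b c : point) : Prop := collinear b c x.

Definition angle (u v w : point) : R :=
  acos (dot (vsub u v) (vsub w v) / (norm (vsub u v) * norm (vsub w v))).

Definition on_circle3 (x u v w : point) : Prop :=
  nondeg u v w /\
  exists o : point, dist o u = dist o v /\ dist o u = dist o w /\ dist o u = dist o x.

Definition inside (p a b c : point) : Prop :=
  (0 < orient a b p * orient a b c) /\
  (0 < orient b c p * orient b c a) /\
  (0 < orient c a p * orient c a b).

Definition miquel (a b c x y z p : point) : Prop :=
  on_line x b c /\ on_line y c a /\ on_line z a b /\
  on_circle3 p a y z /\ on_circle3 p b z x /\ on_circle3 p c x y.

Definition sim_ord (a b c a' b' c' : point) : Prop :=
  exists k : R, 0 < k /\
    dist a' b' = k * dist a b /\ dist b' c' = k * dist b c /\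
    dist c' a' = k * dist c a.

Definition similar (a b c a' b' c' : point) : Prop :=
  sim_ord a b c a' b' c' \/ sim_ord a b c a' c' b' \/
  sim_ord a b c b' a' c' \/ sim_ord a b c b' c' a' \/
  sim_ord a b c c' a' b' \/ sim_ord a b c c' b' a'.

Definition first_brocard (p a b c : point) : Prop :=
  inside p a b c /\ angle b a p = angle c b p /\ angle c b p = angle a c p.

Definition second_brocard (p a b c : point) : Prop :=
  inside p a b c /\ angle p a c = angle p b a /\ angle p b a = angle p c b.

Definition circumcenter (o a b c : point) : Prop :=
  dist o a = dist o b /\ dist o a = dist o c.

Definition orthocenter (h a b c : point) : Prop :=
  dot (vsub h a) (vsub c b) = 0 /\ dot (vsub h b) (vsub a c) = 0.

(* direction of the symmedian from a: reflection of the median direction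
   in the (internal) angle bisector at a *)
Definition symmedian_dir (a b c : point) : point :=
  let m := vsub (midpoint b c) a in
  let u := vadd (vscale (/ dist a b) (vsub b a)) (vscale (/ dist a c) (vsub c a)) in
  vsub (vscale (2 * dot m u / dot u u) u) m.

(* S_A : the point where the ray from a along the symmedian meets the arc bc
   of the circle through b, c, O (O circumcenter) containing O *)
Definition is_S (a b c s : point) : Prop :=
  exists o : point, circumcenter o a b c /\
  (exists t : R, 0 < t /\ s = vadd a (vscale t (symmedian_dir a b c))) /\
  on_circle3 s b c o /\
  0 < orient b c s * orient b c o.

Definition is_M (a b c m : point) : Prop :=
  let e := midpoint b c in
  (0 < dot (vsub b a) (vsub c a) /\
     exists f : point, on_line f a e /\ f <> a /\ on_circle3 f a b c /\
       (exists t : R, 0 <= t <= 1 /\ m = vadd a (vscale t (vsub e a))) /\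
       dist e m = dist e f)
  \/
  (dot (vsub b a) (vsub c a) < 0 /\
     let f := vsub (vadd b c) a in
     on_line m a e /\ m <> f /\ on_circle3 m f b c).

(* Main.v *)
From Stdlib Require Import Reals Arith Lra.
From Coquelicot Require Import Coquelicot.
Require Import Defs.
Open Scope R_scope.

(** Put P at the origin of the complex plane. The Miquel condition says that the lines PX, PY, PZ
    meet BC, CA, AB at one common directed angle, so XYZ is the pedal triangle of P up to a spiral
    similarity about P: x = nu (2i b×c) / conj (c - b) and cyclically.  Three consequences follow.
    The sides of XYZ are proportional to PA·BC, PB·CA, PC·AB.  The products a·x·x' over two
    consecutive steps agree at the three vertices, so three steps amount to a spiral similarity
    about P (Neuberg).  The first Brocard condition says that BCA itself satisfies these
    equations, so one step takes BCA to XYZ by a spiral similarity.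

    It remains to treat one step for the circumcenter (|a| = |b| = |c|) and for S_A, which is
    characterised by a² = bc, and two steps for the orthocenter (a·b = b·c = c·a) and for M_A,
    characterised by conj(a)(b + c) = 2 b·c.  After two steps the sides are proportional to
    |a| |b×c|, |b| |c×a|, |c| |a×b|. *)

(** * Circles and lines in coordinates, and the angle condition contained in a Miquel circle *)

Lemma dot_self_ge0 (u : point) : 0 <= dot u u.
Proof. unfold dot; nra. Qed.

Lemma dist_eq_sq (p q r s : point) :
  dist p q = dist r s ->
  dot (vsub p q) (vsub p q) = dot (vsub r s) (vsub r s).
Proof. intros H; apply sqrt_inj; [apply dot_self_ge0 | apply dot_self_ge0 | exact H]. Qed.

(** Taking [x] as origin, a point u of a circle through [x] with center o satisfies |u|^2 = 2 o.u.
    Substituting this for the three points reduces the claim to the plane identity u (v×w) + v (w×u)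
    + w (u×v) = 0, dotted with 2 o. *)
Lemma concyclic_det (x u v w : point) :
  on_circle3 x u v w ->
  dot (vsub u x) (vsub u x) * cross (vsub v x) (vsub w x)
  + dot (vsub v x) (vsub v x) * cross (vsub w x) (vsub u x)
  + dot (vsub w x) (vsub w x) * cross (vsub u x) (vsub v x) = 0.
Proof.
intros [_ [o [H1 [H2 H3]]]].
apply dist_eq_sq in H1, H2, H3.
destruct x as [x1 x2], u as [u1 u2], v as [v1 v2], w as [w1 w2], o as [o1 o2].
unfold dot, cross, vsub, px, py in *; simpl in *.
set (k := (o1 - u1) * (o1 - u1) + (o2 - u2) * (o2 - u2)) in *.
assert (Hu : (u1 - x1) * (u1 - x1) + (u2 - x2) * (u2 - x2)
             = 2 * ((o1 - x1) * (u1 - x1) + (o2 - x2) * (u2 - x2))) by (unfold k in *; lra).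
assert (Hv : (v1 - x1) * (v1 - x1) + (v2 - x2) * (v2 - x2)
             = 2 * ((o1 - x1) * (v1 - x1) + (o2 - x2) * (v2 - x2))) by (unfold k in *; lra).
assert (Hw : (w1 - x1) * (w1 - x1) + (w2 - x2) * (w2 - x2)
             = 2 * ((o1 - x1) * (w1 - x1) + (o2 - x2) * (w2 - x2))) by (unfold k in *; lra).
rewrite Hu, Hv, Hw; ring.
Qed.

Lemma on_line_param (x b c : point) :
  b <> c -> on_line x b c -> exists q, x = vadd b (vscale q (vsub c b)).
Proof.
intros Hbc H.
destruct x as [x1 x2], b as [b1 b2], c as [c1 c2].
unfold on_line, collinear, orient, cross, vadd, vscale, vsub, px, py in *; simpl in *.
assert (Hn : (c1 - b1) * (c1 - b1) + (c2 - b2) * (c2 - b2) <> 0).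
{ intros E; apply Rplus_sqr_eq_0 in E; apply Hbc; f_equal; lra. }
(* The parameter of the orthogonal projection of [x] on the line; what is left over in each
   coordinate is a multiple of the collinearity determinant [H]. *)
exists (((x1 - b1) * (c1 - b1) + (x2 - b2) * (c2 - b2))
        / ((c1 - b1) * (c1 - b1) + (c2 - b2) * (c2 - b2))).
f_equal; apply Rminus_diag_uniq; field_simplify; trivial;
  unfold Rdiv; apply Rmult_eq_0_compat_r;
  [ transitivity (- (c2 - b2) * ((c1 - b1) * (x2 - b2) - (c2 - b2) * (x1 - b1)))
  | transitivity ((c1 - b1) * ((c1 - b1) * (x2 - b2) - (c2 - b2) * (x1 - b1))) ];
  (ring || (rewrite H; ring)).
Qed.

Lemma on_line_sym (x b c : point) : on_line x b c -> on_line x c b.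
Proof.
unfold on_line, collinear, orient, cross, vsub, px, py; simpl; intros H.
transitivity (- 0); [rewrite <- H|]; ring.
Qed.

(* Up to sign, dot (y - p) (a - c) / cross (c - p) (a - p) is the tangent of the angle at p from the
   perpendicular to ca to py; the denominators are cleared. *)
Lemma miquel_slant (a b c y z p : point) :
  ~ on_line p c a -> ~ on_line p a b ->
  on_line y c a -> on_line z a b -> on_circle3 p a y z ->
  dot (vsub y p) (vsub a c) * cross (vsub a p) (vsub b p)
  = dot (vsub z p) (vsub b a) * cross (vsub c p) (vsub a p).
Proof.
intros Hca Hab Hy Hz Hc.
assert (Dac : a <> c).
{ intros ->; apply Hca; unfold on_line, collinear, orient, cross; simpl; ring. }
assert (Dab : a <> b).
{ intros ->; apply Hab; unfold on_line, collinear, orient, cross; simpl; ring. }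
apply on_line_sym in Hy.
destruct (on_line_param y a c Dac Hy) as [q ->].
destruct (on_line_param z a b Dab Hz) as [r ->].
pose proof (concyclic_det _ _ _ _ Hc) as E.
destruct Hc as [Hn _].
assert (Hq : q <> 0).
{ intros ->; apply Hn; unfold collinear, orient, cross, vsub, vadd, vscale, px, py; simpl; ring. }
assert (Hr : r <> 0).
{ intros ->; apply Hn; unfold collinear, orient, cross, vsub, vadd, vscale, px, py; simpl; ring. }
(* The concyclicity determinant of [p], [a], [y], [z] is exactly [q * r] times the difference of the
   two sides. *)
apply Rminus_diag_uniq, (Rmult_eq_reg_l (q * r)); [| now apply Rmult_integral_contrapositive].
rewrite Rmult_0_r, <- E.
unfold dot, cross, vsub, vadd, vscale, px, py; simpl; ring.
Qed.

(** * Miquel triangles in complex form *)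

(** Both [point] and [C] are [R * R], so a vector issuing from [p] is read as a complex number
    without any conversion. *)
Definition from (p x : point) : C := vsub x p.

(* 2i times the cross product *)
Definition csk (u v : C) : C := (Cconj u * v - u * Cconj v)%C.

(** For [nu = -1/2] these are the feet of the perpendiculars from the origin; real part -1/2 is what
    puts the points on the side lines. The predicate keeps the fact that one nonzero [nu] serves all
    three vertices. *)
Definition feet (nu a b c x y z : C) : Prop :=
  (nu <> 0 /\
   x = nu * csk b c / Cconj (c - b) /\
   y = nu * csk c a / Cconj (a - c) /\
   z = nu * csk a b / Cconj (b - a))%C.

(** The origin is on no side line, and the triangle is nondegenerate: the last sum is 2i times
    [orient]. *)
Definition admissible (a b c : C) : Prop :=
  (csk b c <> 0 /\ csk c a <> 0 /\ csk a b <> 0 /\ csk b c + csk c a + csk a b <> 0)%C.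

Lemma csk_cross (u v : C) : csk u v = (0, 2 * cross u v).
Proof.
destruct u as [u1 u2], v as [v1 v2].
unfold csk, cross, Cconj, Cminus, Cmult, Cplus, Copp; simpl.
f_equal; ring.
Qed.

Lemma Cim_neq_0 (r : R) : r <> 0 -> ((0, 2 * r) : C) <> 0%C.
Proof. intros H E; apply H; injection E; lra. Qed.

Lemma on_line_cross (p b c : point) : on_line p b c <-> cross (vsub b p) (vsub c p) = 0.
Proof.
unfold on_line, collinear.
replace (orient b c p) with (cross (vsub b p) (vsub c p)); [tauto |].
unfold orient, cross, vsub, px, py; simpl; ring.
Qed.

Lemma admissible_from (a b c p : point) :
  nondeg a b c -> ~ on_line p b c -> ~ on_line p c a -> ~ on_line p a b ->
  admissible (from p a) (from p b) (from p c).
Proof.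
intros H0 H1 H2 H3; unfold admissible; rewrite !csk_cross.
repeat split; try apply Cim_neq_0; intros E.
- now apply H1, on_line_cross.
- now apply H2, on_line_cross.
- now apply H3, on_line_cross.
- apply H0; injection E; intros E' _; unfold collinear.
  apply (Rmult_eq_reg_l 2); [| lra].
  rewrite Rmult_0_r, <- E'; unfold orient, cross, from, vsub, px, py; simpl; ring.
Qed.

Lemma csk_diff (u v : C) : csk u v <> 0%C -> Cminus v u <> 0%C /\ Cconj (v - u) <> 0%C.
Proof.
intros H.
assert (D : Cminus v u <> 0%C).
{ intros E; apply H.
  assert (v = u) as -> by (replace v with (u + (v - u))%C by ring; rewrite E; ring).
  unfold csk; ring. }
split; trivial.
apply Cmod_gt_0; rewrite Cmod_conj; apply Cmod_gt_0; exact D.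
Qed.

Lemma csk_neq0 (u v : C) : csk u v <> 0%C ->
  (u <> 0 /\ Cconj u <> 0 /\ v <> 0 /\ Cconj v <> 0)%C.
Proof.
intros H.
assert (Hu : u <> 0%C).
{ intros ->; apply H; unfold csk; apply injective_projections; simpl; ring. }
assert (Hv : v <> 0%C).
{ intros ->; apply H; unfold csk; apply injective_projections; simpl; ring. }
repeat split; trivial; apply Cmod_gt_0; rewrite Cmod_conj; apply Cmod_gt_0; assumption.
Qed.

(** With [p] as origin, x conj(c - b) has real part x.(c - b), which is t (b×c), and imaginary part
    (c - b)×x, which is -(b×c) because [x] is on the line. Together these make (-1/2 - i t/2) times
    2i (b×c). *)
Lemma foot_eq (t : R) (b c x p : point) :
  ~ on_line p b c -> on_line x b c ->
  dot (vsub x p) (vsub c b) = t * cross (vsub b p) (vsub c p) ->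
  from p x = (((-1/2)%R, (- t/2)%R) * csk (from p b) (from p c) / Cconj (from p c - from p b))%C.
Proof.
intros Hp Hx Ht.
assert (Hcr : csk (from p b) (from p c) <> 0%C).
{ rewrite csk_cross; apply Cim_neq_0; intros E; now apply Hp, on_line_cross. }
destruct (csk_diff _ _ Hcr) as [_ Hd].
transitivity (from p x * Cconj (from p c - from p b) / Cconj (from p c - from p b))%C.
{ field; exact Hd. }
f_equal; rewrite csk_cross.
destruct x as [x1 x2], b as [b1 b2], c as [c1 c2], p as [p1 p2].
unfold on_line, collinear, orient, from, dot, cross, vsub, px, py in *; simpl in *.
apply injective_projections; simpl; lra.
Qed.

Lemma miquel_feet (a b c x y z p : point) :
  ~ on_line p b c -> ~ on_line p c a -> ~ on_line p a b ->
  miquel a b c x y z p ->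
  exists nu, feet nu (from p a) (from p b) (from p c) (from p x) (from p y) (from p z).
Proof.
intros Hbc Hca Hab [Hx [Hy [Hz [Ca [Cb _]]]]].
pose proof (miquel_slant _ _ _ _ _ _ Hca Hab Hy Hz Ca) as Sa.
pose proof (miquel_slant _ _ _ _ _ _ Hab Hbc Hz Hx Cb) as Sb.
assert (D : forall u v, ~ on_line p u v -> cross (vsub u p) (vsub v p) <> 0).
{ intros u v H E; now apply H, on_line_cross. }
apply D in Hbc as Dbc; apply D in Hca as Dca; apply D in Hab as Dab.
(* The common slant, read off at [z]; the circle through [a] carries it to [y] and the circle
   through [b] carries it to [x]. *)
set (t := dot (vsub z p) (vsub b a) / cross (vsub a p) (vsub b p)).
exists (-1/2, - t/2); split; [| split; [| split]].
- intros E; injection E; lra.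
- apply foot_eq; trivial; unfold t.
  apply (Rmult_eq_reg_l (cross (vsub a p) (vsub b p))); trivial.
  field_simplify; trivial; lra.
- apply foot_eq; trivial; unfold t.
  apply (Rmult_eq_reg_l (cross (vsub a p) (vsub b p))); trivial.
  field_simplify; trivial; lra.
- apply foot_eq; trivial; unfold t; field; trivial.
Qed.

(** * Edges of a Miquel triangle, and Neuberg's theorem on three steps *)

(** Over the common denominator the numerator factors, with conj(a) and the area as factors. In
    absolute value, with [nu = -1/2], this is the classical length PA·BC/(2R) of a pedal side. *)
Lemma feet_diff (nu a b c x y z : C) :
  admissible a b c -> feet nu a b c x y z ->
  (y - z = - nu * (csk b c + csk c a + csk a b) * Cconj a
           / (Cconj (a - c) * Cconj (b - a)))%C.
Proof.
intros [H1 [H2 [H3 _]]] [_ [_ [-> ->]]].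
apply csk_diff in H1, H2, H3.
destruct H2 as [_ H2], H3 as [_ H3].
revert H2 H3; rewrite !Cminus_conj; intros H2 H3.
unfold csk; field; split; assumption.
Qed.

Lemma csk_conj (u v : C) : Cconj (csk u v) = (- csk u v)%C.
Proof. unfold csk; rewrite Cminus_conj, !Cmult_conj, !Cconj_conj; ring. Qed.

Lemma Cconj_neq0 (u : C) : u <> 0%C -> Cconj u <> 0%C.
Proof. intros H; apply Cmod_gt_0; rewrite Cmod_conj; now apply Cmod_gt_0. Qed.

(** The point of this formula is that its right-hand side does not change when the vertices are
    permuted cyclically. *)
Lemma feet_product (nu nu' a b c x y z x' y' z' : C) :
  admissible a b c -> feet nu a b c x y z -> feet nu' x y z x' y' z' ->
  (a * x * x' = nu * nu * nu' * csk b c * csk c a * csk a b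
                / (Cconj (a - c) * Cconj (b - a) * Cconj (c - b)))%C.
Proof.
intros Ha F [_ [-> _]].
pose proof (feet_diff _ _ _ _ _ _ _ Ha F) as D.
destruct Ha as [H1 [H2 [H3 H4]]], F as [Hnu [-> [Ey Ez]]].
destruct (csk_diff _ _ H1) as [_ K1], (csk_diff _ _ H2) as [L2 K2], (csk_diff _ _ H3) as [L3 K3].
destruct (csk_neq0 _ _ H3) as [La _].
apply Cconj_neq0 in Hnu as Hnu'.
set (T := (csk b c + csk c a + csk a b)%C) in *.
(* This is [csk (a - c) (b - a)]: the area expressed by the two edges at [a]. *)
assert (ES : T = (Cconj (a - c) * (b - a) - (a - c) * Cconj (b - a))%C).
{ unfold T, csk; rewrite !Cminus_conj; ring. }
assert (ES' : Cconj T = (- T)%C).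
{ unfold T; rewrite !Cplus_conj, !csk_conj; ring. }
clearbody T.
assert (Ed : Cconj (z - y) = (- Cconj nu * T * a / ((a - c) * (b - a)))%C).
{ replace (z - y)%C with (- (y - z))%C by ring.
  rewrite Copp_conj, D, Cdiv_conj, !Cmult_conj, Copp_conj, !Cconj_conj, ES' by now apply Cmult_neq_0.
  field; split; assumption. }
(* [y] and [z] are [nu] times imaginary multiples of [a - c] and [b - a], so their cross product is
   proportional to that of these edges, hence to [T]. *)
assert (Ec : csk y z = (- nu * Cconj nu * csk c a * csk a b * T
              / ((a - c) * (b - a) * Cconj (a - c) * Cconj (b - a)))%C).
{ unfold csk at 1; rewrite Ey, Ez, !Cdiv_conj, !Cmult_conj, !csk_conj, !Cconj_conj by assumption.
  rewrite ES; field; repeat split; assumption. }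
rewrite Ed, Ec; field; repeat split; assumption.
Qed.

Lemma feet_rot (nu a b c x y z : C) : feet nu a b c x y z -> feet nu b c a y z x.
Proof. unfold feet; tauto. Qed.

Lemma admissible_rot (a b c : C) : admissible a b c -> admissible b c a.
Proof.
intros [H1 [H2 [H3 H4]]]; repeat split; trivial.
intros E; apply H4; rewrite <- E; ring.
Qed.

Lemma admissible_neq0 (a b c : C) :
  admissible a b c -> (a <> 0 /\ b <> 0 /\ c <> 0)%C.
Proof.
intros [H1 [H2 _]].
destruct (csk_neq0 _ _ H1) as [Hb [_ [Hc _]]], (csk_neq0 _ _ H2) as [_ [_ [Ha _]]]; auto.
Qed.

Lemma feet_product_eq (nu nu' a b c x y z x' y' z' : C) :
  admissible a b c -> feet nu a b c x y z -> feet nu' x y z x' y' z' ->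
  (a * x * x' = b * y * y' /\ a * x * x' = c * z * z')%C.
Proof.
intros Ha F F'.
pose proof (feet_product _ _ _ _ _ _ _ _ _ _ _ Ha F F') as E.
apply admissible_rot in Ha as Hb; apply feet_rot in F as G; apply feet_rot in F' as G'.
pose proof (feet_product _ _ _ _ _ _ _ _ _ _ _ Hb G G') as E1.
apply admissible_rot in Hb as Hc; apply feet_rot in G; apply feet_rot in G'.
pose proof (feet_product _ _ _ _ _ _ _ _ _ _ _ Hc G G') as E2.
destruct Ha as [H1 [H2 [H3 _]]].
destruct (csk_diff _ _ H1) as [_ K1], (csk_diff _ _ H2) as [_ K2], (csk_diff _ _ H3) as [_ K3].
rewrite E, E1, E2; split; field; repeat split; assumption.
Qed.

Lemma ratio_of_products (k k' u u1 u2 u3 v v1 v2 v3 : C) :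
  (k <> 0 -> u <> 0 -> k = u * u1 * u2 -> k = v * v1 * v2 ->
   k' = u1 * u2 * u3 -> k' = v1 * v2 * v3 -> v3 = u3 / u * v)%C.
Proof.
intros Hk Hu Eu Ev Eu' Ev'.
assert (H : (k * (v3 * u) = k * (u3 * v))%C).
{ transitivity (u * v * k')%C.
  - rewrite Ev, Ev'; ring.
  - rewrite Eu, Eu'; ring. }
transitivity (/ k * (k * (v3 * u)) / u)%C; [field; auto |].
rewrite H; field; auto.
Qed.

(** The products over stages 0, 1, 2 agree at the three vertices, and so do those over stages 1, 2,
    3. Dividing the second by the first cancels the middle stages and leaves a3/a = b3/b = c3/c. *)
Lemma three_feet_spiral (n0 n1 n2 a b c a1 b1 c1 a2 b2 c2 a3 b3 c3 : C) :
  admissible a b c -> admissible a1 b1 c1 -> admissible a2 b2 c2 -> admissible a3 b3 c3 ->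
  feet n0 a b c a1 b1 c1 -> feet n1 a1 b1 c1 a2 b2 c2 -> feet n2 a2 b2 c2 a3 b3 c3 ->
  exists mu : C, (mu <> 0 /\ a3 = mu * a /\ b3 = mu * b /\ c3 = mu * c)%C.
Proof.
intros H0 H1 H2 H3 F0 F1 F2.
destruct (feet_product_eq _ _ _ _ _ _ _ _ _ _ _ H0 F0 F1) as [E1 E2].
destruct (feet_product_eq _ _ _ _ _ _ _ _ _ _ _ H1 F1 F2) as [E1' E2'].
apply admissible_neq0 in H0, H1, H2, H3.
destruct H0 as [H0 _], H1 as [H1 _], H2 as [H2 _], H3 as [H3 _].
assert (Hk : (a * a1 * a2 <> 0)%C) by (repeat apply Cmult_neq_0; assumption).
exists (a3 / a)%C; split; [| split; [| split]].
- apply Cmult_neq_0; trivial.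
  intros E; apply C1_nz; rewrite <- (Cinv_r a), E by assumption; ring.
- field; assumption.
- now apply (ratio_of_products (a * a1 * a2) (a1 * a2 * a3) a a1 a2 a3 b b1 b2 b3).
- now apply (ratio_of_products (a * a1 * a2) (a1 * a2 * a3) a a1 a2 a3 c c1 c2 c3).
Qed.

(** * Side lengths after one and two steps *)

Lemma Cmod_sub_sym (u v : C) : Cmod (u - v) = Cmod (v - u).
Proof. rewrite <- Cmod_opp; f_equal; ring. Qed.

(** The length |b - c| is inserted above and below, so that the factor in front of [Cmod a] is
    symmetric in the vertices and can serve all three sides. *)
Lemma feet_length (nu a b c x y z : C) :
  admissible a b c -> feet nu a b c x y z ->
  Cmod (y - z) = Cmod nu * Cmod (csk b c + csk c a + csk a b)
                 / (Cmod (a - b) * Cmod (b - c) * Cmod (c - a)) * Cmod a * Cmod (b - c).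
Proof.
intros Ha F.
rewrite (feet_diff _ _ _ _ _ _ _ Ha F).
destruct Ha as [H1 [H2 [H3 _]]].
destruct (csk_diff _ _ H1) as [L1 _], (csk_diff _ _ H2) as [L2 K2], (csk_diff _ _ H3) as [L3 K3].
rewrite Cmod_div by now apply Cmult_neq_0.
rewrite !Cmod_mult, !Cmod_conj, Cmod_opp.
rewrite (Cmod_sub_sym c a), (Cmod_sub_sym a b), (Cmod_sub_sym b c).
apply Cmod_gt_0 in L1, L2, L3.
field; repeat split; now apply Rgt_not_eq.
Qed.

Lemma feet_lengths (nu a b c x y z : C) :
  admissible a b c -> feet nu a b c x y z ->
  exists k, 0 < k /\ Cmod (y - z) = k * Cmod a * Cmod (b - c) /\
    Cmod (z - x) = k * Cmod b * Cmod (c - a) /\ Cmod (x - y) = k * Cmod c * Cmod (a - b).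
Proof.
intros Ha F.
pose proof (feet_length _ _ _ _ _ _ _ Ha F) as E.
apply admissible_rot in Ha as Hb; apply feet_rot in F as G.
pose proof (feet_length _ _ _ _ _ _ _ Hb G) as E1.
apply admissible_rot in Hb as Hc; apply feet_rot in G as G'.
pose proof (feet_length _ _ _ _ _ _ _ Hc G') as E2.
destruct F as [Hnu _], Ha as [H1 [H2 [H3 H4]]].
destruct (csk_diff _ _ H1) as [L1 _], (csk_diff _ _ H2) as [L2 _], (csk_diff _ _ H3) as [L3 _].
apply Cmod_gt_0 in L1, L2, L3, H4, Hnu.
rewrite (Cmod_sub_sym c b) in L1; rewrite (Cmod_sub_sym a c) in L2; rewrite (Cmod_sub_sym b a) in L3.
exists (Cmod nu * Cmod (csk b c + csk c a + csk a b)
        / (Cmod (a - b) * Cmod (b - c) * Cmod (c - a))).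
repeat split; trivial.
- apply Rdiv_lt_0_compat; repeat apply Rmult_lt_0_compat; assumption.
- rewrite E1.
  replace (csk c a + csk a b + csk b c)%C with (csk b c + csk c a + csk a b)%C by ring.
  field; repeat split; now apply Rgt_not_eq.
- rewrite E2.
  replace (csk a b + csk b c + csk c a)%C with (csk b c + csk c a + csk a b)%C by ring.
  field; repeat split; now apply Rgt_not_eq.
Qed.

(** For the pedal foot this is base times height in the triangle spanned by the origin, [b] and
    [c]. *)
Lemma feet_mod (nu a b c x y z : C) :
  admissible a b c -> feet nu a b c x y z ->
  Cmod x * Cmod (b - c) = Cmod nu * Cmod (csk b c).
Proof.
intros [H1 _] [_ [-> _]].
destruct (csk_diff _ _ H1) as [L1 K1].
rewrite Cmod_div, Cmod_mult, Cmod_conj, (Cmod_sub_sym b c) by assumption.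
apply Cmod_gt_0 in L1; field; now apply Rgt_not_eq.
Qed.

(** Two applications of the one-step law give a multiple of |x| |a| |b - c|, in which [feet_mod]
    replaces |x| |b - c| by a multiple of |csk b c|. *)
Lemma feet2_lengths (nu nu' a b c x y z x' y' z' : C) :
  admissible a b c -> admissible x y z ->
  feet nu a b c x y z -> feet nu' x y z x' y' z' ->
  exists k, 0 < k /\ Cmod (y' - z') = k * (Cmod a * Cmod (csk b c)) /\
    Cmod (z' - x') = k * (Cmod b * Cmod (csk c a)) /\
    Cmod (x' - y') = k * (Cmod c * Cmod (csk a b)).
Proof.
intros Ha Hx F F'.
destruct (feet_lengths _ _ _ _ _ _ _ Ha F) as [k [Hk [E1 [E2 E3]]]].
destruct (feet_lengths _ _ _ _ _ _ _ Hx F') as [k' [Hk' [E1' [E2' E3']]]].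
pose proof (feet_mod _ _ _ _ _ _ _ Ha F) as M1.
apply admissible_rot in Ha as Hb; apply feet_rot in F as G.
pose proof (feet_mod _ _ _ _ _ _ _ Hb G) as M2.
apply admissible_rot in Hb as Hc; apply feet_rot in G as G'.
pose proof (feet_mod _ _ _ _ _ _ _ Hc G') as M3.
destruct F as [Hnu _]; apply Cmod_gt_0 in Hnu.
exists (k * k' * Cmod nu); repeat split.
- repeat apply Rmult_lt_0_compat; assumption.
- rewrite E1', E1; transitivity (k * k' * Cmod a * (Cmod x * Cmod (b - c))); [| rewrite M1]; ring.
- rewrite E2', E2; transitivity (k * k' * Cmod b * (Cmod y * Cmod (c - a))); [| rewrite M2]; ring.
- rewrite E3', E3; transitivity (k * k' * Cmod c * (Cmod z * Cmod (a - b))); [| rewrite M3]; ring.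
Qed.

(** * Labeled and unlabeled similarity *)

Lemma dist_from (p x y : point) : dist x y = Cmod (from p x - from p y).
Proof.
unfold dist, norm, Cmod; f_equal.
unfold dot, from, vsub, px, py; simpl; ring.
Qed.

Lemma dist_sym (x y : point) : dist x y = dist y x.
Proof. unfold dist, norm; f_equal; unfold dot, vsub, px, py; simpl; ring. Qed.

Lemma sim_ord_rot (a b c a' b' c' : point) :
  sim_ord a b c a' b' c' -> sim_ord b c a b' c' a'.
Proof. intros [k [Hk [H1 [H2 H3]]]]; exists k; auto. Qed.

Lemma sim_ord_swap (a b c a' b' c' : point) :
  sim_ord a b c a' b' c' -> sim_ord a c b a' c' b'.
Proof.
intros [k [Hk [H1 [H2 H3]]]]; exists k.
rewrite (dist_sym a' c'), (dist_sym c' b'), (dist_sym b' a'),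
  (dist_sym a c), (dist_sym c b), (dist_sym b a); auto.
Qed.

Lemma sim_ord_trans (a b c a' b' c' a'' b'' c'' : point) :
  sim_ord a b c a' b' c' -> sim_ord a' b' c' a'' b'' c'' -> sim_ord a b c a'' b'' c''.
Proof.
intros [k [Hk [H1 [H2 H3]]]] [l [Hl [H1' [H2' H3']]]].
exists (l * k); rewrite H1', H2', H3', H1, H2, H3.
repeat split; [now apply Rmult_lt_0_compat | ring | ring | ring].
Qed.

Lemma sim_ord_refl (a b c : point) : sim_ord a b c a b c.
Proof. exists 1; repeat split; lra. Qed.

Lemma similar_trans_sim_ord (a b c a' b' c' a'' b'' c'' : point) :
  similar a b c a' b' c' -> sim_ord a' b' c' a'' b'' c'' -> similar a b c a'' b'' c''.
Proof.
intros H S1.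
(* All six relabelings of the second similarity are prepared, one to compose with each disjunct of
   the first. *)
pose proof (sim_ord_rot _ _ _ _ _ _ S1) as S2.
pose proof (sim_ord_rot _ _ _ _ _ _ S2) as S3.
pose proof (sim_ord_swap _ _ _ _ _ _ S1) as S1'.
pose proof (sim_ord_swap _ _ _ _ _ _ S2) as S2'.
pose proof (sim_ord_swap _ _ _ _ _ _ S3) as S3'.
unfold similar in *; intuition eauto 8 using sim_ord_trans.
Qed.

Lemma similar_rot_r (a b c a' b' c' : point) :
  similar a b c a' b' c' -> similar a b c b' c' a'.
Proof. unfold similar; tauto. Qed.

Lemma similar_rot_l (a b c a' b' c' : point) :
  similar b c a a' b' c' -> similar a b c a' b' c'.
Proof.
unfold similar; intros H.
repeat match type of H with _ \/ _ => destruct H as [H | H] end;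
  apply sim_ord_rot, sim_ord_rot in H; tauto.
Qed.

Lemma similar_swap (a b c a' b' c' : point) :
  similar a c b a' c' b' -> similar a b c a' b' c'.
Proof.
unfold similar; intros H.
repeat match type of H with _ \/ _ => destruct H as [H | H] end;
  apply sim_ord_swap in H; tauto.
Qed.

Definition spiral (p : point) (mu : C) (x x' : point) : Prop := from p x' = (mu * from p x)%C.

Lemma sim_ord_spiral (p : point) (mu : C) (a b c a' b' c' : point) :
  mu <> 0%C -> spiral p mu a a' -> spiral p mu b b' -> spiral p mu c c' ->
  sim_ord a b c a' b' c'.
Proof.
intros Hmu Ea Eb Ec; exists (Cmod mu); split; [now apply Cmod_gt_0 |].
rewrite !(dist_from p), Ea, Eb, Ec, <- !Cmod_mult.
repeat split; f_equal; ring.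
Qed.

(** * Brocard points *)

(** Equality of the two cotangents, cleared of denominators. Equal cosines determine the sine only
    up to sign; the common orientation decides the sign. *)
Lemma angle_dot_cross (q1 v1 r1 q2 v2 r2 : point) :
  angle q1 v1 r1 = angle q2 v2 r2 -> 0 < orient v1 q1 r1 * orient v2 q2 r2 ->
  dot (vsub q1 v1) (vsub r1 v1) * orient v2 q2 r2
  = dot (vsub q2 v2) (vsub r2 v2) * orient v1 q1 r1.
Proof.
unfold angle, orient.
generalize (vsub q1 v1) (vsub r1 v1) (vsub q2 v2) (vsub r2 v2); clear.
intros u1 w1 u2 w2 H Hc.
assert (D : forall u w : point, cross u w <> 0 ->
  0 < norm u * norm w /\
  (norm u * norm w) * (norm u * norm w) = dot u w * dot u w + cross u w * cross u w).
{ intros u w Hn.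
  assert (E : (norm u * norm w) * (norm u * norm w) = dot u w * dot u w + cross u w * cross u w).
  { unfold norm.
    transitivity ((sqrt (dot u u) * sqrt (dot u u)) * (sqrt (dot w w) * sqrt (dot w w))); [ring |].
    rewrite !sqrt_sqrt by apply dot_self_ge0.
    unfold dot, cross; ring. }
  split; trivial.
  assert (0 <= norm u * norm w) by (apply Rmult_le_pos; apply sqrt_pos).
  nra. }
assert (N1 : cross u1 w1 <> 0) by (intros E; rewrite E in Hc; lra).
assert (N2 : cross u2 w2 <> 0) by (intros E; rewrite E in Hc; lra).
destruct (D _ _ N1) as [P1 Q1], (D _ _ N2) as [P2 Q2]; clear D.
revert H P1 Q1 P2 Q2.
generalize (norm u1 * norm w1) (norm u2 * norm w2); intros n1 n2 H P1 Q1 P2 Q2.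
revert H Hc N1 N2 Q1 Q2.
generalize (dot u1 w1) (dot u2 w2) (cross u1 w1) (cross u2 w2).
intros d1 d2 c1 c2 H Hc N1 N2 Q1 Q2.
(* The quotients inside [acos] lie in its proper domain, so that applying [cos] recovers them. *)
assert (B : forall n d c, 0 < n -> n * n = d * d + c * c -> -1 <= d / n <= 1).
{ intros n d c Hn E; split.
  - apply Rle_div_r; trivial; apply Rnot_lt_le; intros L.
    assert (0 < (- d - n) * (n - d)) by (apply Rmult_lt_0_compat; lra); nra.
  - apply Rle_div_l; trivial; apply Rnot_lt_le; intros L.
    assert (0 < (d - n) * (d + n)) by (apply Rmult_lt_0_compat; lra); nra. }
apply (f_equal cos) in H.
rewrite !cos_acos in H by eauto.
assert (E : d1 * n2 = d2 * n1).
{ transitivity (d1 / n1 * (n1 * n2)); [field; lra |]; rewrite H; field; lra. }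
assert (E' : (c1 * n2 - c2 * n1) * (c1 * n2 + c2 * n1) = 0).
{ assert (R1 : c1 * c1 = n1 * n1 - d1 * d1) by lra.
  assert (R2 : c2 * c2 = n2 * n2 - d2 * d2) by lra.
  transitivity (c1 * c1 * (n2 * n2) - c2 * c2 * (n1 * n1)); [ring |].
  rewrite R1, R2.
  transitivity ((d2 * n1 - d1 * n2) * (d2 * n1 + d1 * n2)); [ring | rewrite E; ring]. }
apply Rmult_integral in E'; destruct E' as [E' | E'].
- apply (Rmult_eq_reg_r (n1 * n2)); [| nra].
  transitivity ((d1 * n2) * (c2 * n1)); [ring |].
  rewrite E; replace (c2 * n1) with (c1 * n2) by lra; ring.
- exfalso; nra.
Qed.

Lemma orient_from (p a b : point) : orient a b p = cross (from p a) (from p b).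
Proof. unfold orient, cross, from, vsub, px, py; simpl; ring. Qed.

(** The points [b], [c], [a] lie on bc, ca, ab, and the equal Brocard angles say that pb, pc, pa
    meet these lines at one directed angle. So [foot_eq] applies three times with the same slant. *)
Lemma first_brocard_feet (p a b c : point) :
  ~ on_line p b c -> ~ on_line p c a -> ~ on_line p a b ->
  first_brocard p a b c ->
  exists nu, feet nu (from p a) (from p b) (from p c) (from p b) (from p c) (from p a).
Proof.
intros Hbc Hca Hab [[I1 [I2 I3]] [A1 A2]].
assert (Eo : orient b c a = orient a b c) by (unfold orient, cross, vsub, px, py; simpl; ring).
assert (Eo' : orient c a b = orient a b c) by (unfold orient, cross, vsub, px, py; simpl; ring).
rewrite Eo in I2; rewrite Eo' in I3.
(* Being [inside] gives [p] the same orientation with respect to all three sides. *)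
apply angle_dot_cross in A1; [| nra].
apply angle_dot_cross in A2; [| nra].
rewrite !(orient_from p) in *.
assert (D : forall u v, dot (vsub v u) (vsub p u) = - dot (vsub u p) (vsub v u)).
{ intros u v; unfold dot, vsub, px, py; simpl; ring. }
rewrite !D in *; unfold from in *.
(* Up to sign, the cotangent of the Brocard angle. *)
set (t := dot (vsub b p) (vsub c b) / cross (vsub b p) (vsub c p)).
exists ((-1/2)%R, (- t/2)%R); split; [| split; [| split]].
- intros E; injection E; lra.
- apply foot_eq; trivial.
  + unfold on_line, collinear, orient, cross, vsub, px, py; simpl; ring.
  + unfold t; field; intros E; rewrite E in I2; lra.
- apply foot_eq; trivial.
  + unfold on_line, collinear, orient, cross, vsub, px, py; simpl; ring.
  + unfold t; apply (Rmult_eq_reg_l (cross (vsub b p) (vsub c p)));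
      [field_simplify; [lra |] |]; intros E; rewrite E in I2; lra.
- apply foot_eq; trivial.
  + unfold on_line, collinear, orient, cross, vsub, px, py; simpl; ring.
  + unfold t; apply (Rmult_eq_reg_l (cross (vsub b p) (vsub c p)));
      [field_simplify; [lra |] |]; intros E; rewrite E in I2; lra.
Qed.

Lemma feet_proportional (nu nu' a b c x y z x' y' z' : C) :
  feet nu a b c x y z -> feet nu' a b c x' y' z' ->
  exists mu : C, (mu <> 0 /\ x' = mu * x /\ y' = mu * y /\ z' = mu * z)%C.
Proof.
intros [H [-> [-> ->]]] [H' [-> [-> ->]]].
exists (nu' / nu)%C; split; [| unfold Cdiv; repeat split].
- intros E; apply H'; transitivity (nu' / nu * nu)%C; [field; trivial | rewrite E; ring].
- transitivity (nu' * (/ nu * nu) * csk b c * / Cconj (c - b))%C; [rewrite Cinv_l by trivial|]; ring.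
- transitivity (nu' * (/ nu * nu) * csk c a * / Cconj (a - c))%C; [rewrite Cinv_l by trivial|]; ring.
- transitivity (nu' * (/ nu * nu) * csk a b * / Cconj (b - a))%C; [rewrite Cinv_l by trivial|]; ring.
Qed.

Lemma spiral_center (p : point) (mu : C) : spiral p mu p p.
Proof. unfold spiral, from, vsub, px, py; apply injective_projections; simpl; ring. Qed.

Lemma spiral_sub (p : point) (mu : C) (x y x' y' : point) :
  spiral p mu x x' -> spiral p mu y y' -> vsub x' y' = Cmult mu (vsub x y).
Proof.
unfold spiral; intros Hx Hy.
transitivity (Cminus (from p x') (from p y')).
{ unfold from, vsub, px, py; apply injective_projections; simpl; ring. }
rewrite Hx, Hy; unfold from, vsub, px, py; apply injective_projections; simpl; ring.
Qed.

Lemma orient_spiral (p : point) (mu : C) (x y z x' y' z' : point) :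
  spiral p mu x x' -> spiral p mu y y' -> spiral p mu z z' ->
  orient x' y' z' = dot mu mu * orient x y z.
Proof.
intros Hx Hy Hz; unfold orient.
rewrite (spiral_sub _ _ _ _ _ _ Hy Hx), (spiral_sub _ _ _ _ _ _ Hz Hx).
unfold cross, dot, vsub, px, py; simpl; ring.
Qed.

Lemma angle_spiral (p : point) (mu : C) (x y z x' y' z' : point) :
  mu <> 0%C -> spiral p mu x x' -> spiral p mu y y' -> spiral p mu z z' ->
  angle x' y' z' = angle x y z.
Proof.
intros Hmu Hx Hy Hz; unfold angle.
rewrite (spiral_sub _ _ _ _ _ _ Hx Hy), (spiral_sub _ _ _ _ _ _ Hz Hy).
generalize (vsub x y) (vsub z y); intros u v.
assert (N : forall w : point, norm (Cmult mu w) = Cmod mu * norm w).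
{ intros w; transitivity (Cmod (mu * w)).
  - unfold norm, Cmod, dot, px, py; f_equal; simpl; ring.
  - rewrite Cmod_mult; f_equal; unfold norm, Cmod, dot, px, py; f_equal; simpl; ring. }
assert (D : dot (Cmult mu u) (Cmult mu v) = Cmod mu * Cmod mu * dot u v).
{ unfold Cmod; rewrite sqrt_sqrt by nra.
  unfold dot, px, py; simpl; ring. }
apply Cmod_gt_0 in Hmu.
rewrite !N, D; f_equal; unfold Rdiv; rewrite !Rinv_mult.
generalize (/ norm u) (/ norm v); intros; field; lra.
Qed.

Lemma first_brocard_spiral (p : point) (mu : C) (a b c a' b' c' : point) :
  mu <> 0%C -> spiral p mu a a' -> spiral p mu b b' -> spiral p mu c c' ->
  first_brocard p a b c -> first_brocard p a' b' c'.
Proof.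
intros Hmu Ha Hb Hc [[I1 [I2 I3]] [A1 A2]].
pose proof (spiral_center p mu) as Hp.
assert (M : 0 < dot mu mu).
{ destruct (Rle_lt_or_eq_dec _ _ (dot_self_ge0 mu)) as [L | E]; trivial.
  exfalso; apply Hmu, Cmod_eq_0.
  transitivity (sqrt (dot mu mu)); [| rewrite <- E; apply sqrt_0].
  unfold Cmod, dot, px, py; f_equal; ring. }
assert (Q : forall r s, 0 < r * s -> 0 < dot mu mu * r * (dot mu mu * s)).
{ intros r s H; replace (_ * r * _) with (dot mu mu * dot mu mu * (r * s)) by ring.
  apply Rmult_lt_0_compat; [now apply Rmult_lt_0_compat | trivial]. }
split.
- unfold inside.
  rewrite (orient_spiral p mu a b p a' b' p), (orient_spiral p mu a b c a' b' c'),
    (orient_spiral p mu b c p b' c' p), (orient_spiral p mu b c a b' c' a'),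
    (orient_spiral p mu c a p c' a' p), (orient_spiral p mu c a b c' a' b'); auto.
- rewrite (angle_spiral p mu b a p b' a' p), (angle_spiral p mu c b p c' b' p),
    (angle_spiral p mu a c p a' c' p); auto.
Qed.

Lemma first_brocard_rot (p a b c : point) : first_brocard p a b c -> first_brocard p b c a.
Proof.
intros [[I1 [I2 I3]] [A1 A2]]; repeat split; congruence || trivial.
Qed.

Lemma angle_sym (u v w : point) : angle u v w = angle w v u.
Proof. unfold angle; do 2 f_equal; [unfold dot; ring | apply Rmult_comm]. Qed.

Lemma inside_swap (p a b c : point) : inside p a b c -> inside p a c b.
Proof.
assert (D : forall u v w, orient v u w = - orient u v w).
{ intros u v w; unfold orient, cross, vsub, px, py; simpl; ring. }
intros [H1 [H2 H3]]; unfold inside.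
rewrite (D c a p), (D b c p), (D a b p), (D c a b), (D b c a), (D a b c), !Rmult_opp_opp; auto.
Qed.

(** Exchanging two labels turns the statement on second Brocard points into the one on first Brocard
    points. *)
Lemma second_brocard_swap (p a b c : point) : second_brocard p a b c <-> first_brocard p a c b.
Proof.
unfold second_brocard, first_brocard.
rewrite (angle_sym c a p), (angle_sym b c p), (angle_sym a b p).
split; intros [I [A1 A2]]; (split; [now apply inside_swap | split; congruence]).
Qed.

Lemma on_circle3_swap (x u v w : point) : on_circle3 x u v w -> on_circle3 x u w v.
Proof.
intros [Hn [o [H1 [H2 H3]]]]; split; [| exists o; auto].
intros E; apply Hn; unfold collinear in *.
transitivity (- orient u w v); [unfold orient, cross, vsub, px, py; simpl; ring | rewrite E; ring].
Qed.

Lemma miquel_swap (a b c x y z p : point) : miquel a b c x y z p -> miquel a c b x z y p.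
Proof.
intros [Hx [Hy [Hz [Ca [Cb Cc]]]]]; unfold miquel.
auto 10 using on_line_sym, on_circle3_swap.
Qed.

(** * Steps from the circumcenter, the points S, the orthocenter and the points M *)

(** Twice the dot product, the real companion of [csk]. *)
Definition csd (u v : C) : C := (Cconj u * v + u * Cconj v)%C.

Lemma csd_dot (u v : C) : csd u v = (2 * dot u v, 0).
Proof.
destruct u as [u1 u2], v as [v1 v2].
unfold csd, dot, Cconj, Cmult, Cplus; simpl.
f_equal; ring.
Qed.

Lemma csd_conj (u v : C) : Cconj (csd u v) = csd u v.
Proof. unfold csd; rewrite Cplus_conj, !Cmult_conj, !Cconj_conj; ring. Qed.

Lemma sim_ord_from (k : R) (p a b c a' b' c' : point) :
  0 < k ->
  Cmod (from p a' - from p b') = k * Cmod (from p a - from p b) ->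
  Cmod (from p b' - from p c') = k * Cmod (from p b - from p c) ->
  Cmod (from p c' - from p a') = k * Cmod (from p c - from p a) ->
  sim_ord a b c a' b' c'.
Proof. intros Hk H1 H2 H3; exists k; rewrite !(dist_from p); auto. Qed.

Lemma circumcenter_step (nu : C) (p a b c x y z : point) :
  admissible (from p a) (from p b) (from p c) ->
  feet nu (from p a) (from p b) (from p c) (from p x) (from p y) (from p z) ->
  circumcenter p a b c -> similar a b c x y z.
Proof.
intros Ha F [H1 H2].
destruct (feet_lengths _ _ _ _ _ _ _ Ha F) as [k [Hk [E1 [E2 E3]]]].
assert (D : forall u, dist p u = Cmod (from p u)).
{ intros u; rewrite dist_sym, (dist_from p); f_equal.
  unfold from, vsub, px, py; apply injective_projections; simpl; ring. }
rewrite !D in *; rewrite <- H1 in E2; rewrite <- H2 in E3.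
left; apply (sim_ord_from (k * Cmod (from p a)) p); trivial.
apply Rmult_lt_0_compat; trivial.
apply admissible_neq0 in Ha; apply Cmod_gt_0; tauto.
Qed.

(** From a² = bc follow b(c - a) = a(a - b) and c(a - b) = a(c - a). Hence zx and xy are
    proportional to ab and ca with the same factor as yz to bc, and xyz corresponds to acb. *)
Lemma S_step (nu : C) (p a b c x y z : point) :
  admissible (from p a) (from p b) (from p c) ->
  feet nu (from p a) (from p b) (from p c) (from p x) (from p y) (from p z) ->
  (from p a * from p a = from p b * from p c)%C -> similar a b c x y z.
Proof.
intros Ha F E.
destruct (feet_lengths _ _ _ _ _ _ _ Ha F) as [k [Hk [E1 [E2 E3]]]].
apply admissible_neq0 in Ha as [Ha _].
assert (Eb : Cmod (from p b) * Cmod (from p c - from p a)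
             = Cmod (from p a) * Cmod (from p b - from p a)).
{ rewrite <- (Cmod_opp (from p b - from p a)), <- !Cmod_mult; f_equal.
  transitivity (from p b * from p c - from p a * from p b)%C; [ring | rewrite <- E; ring]. }
assert (Ec : Cmod (from p c) * Cmod (from p a - from p b)
             = Cmod (from p a) * Cmod (from p a - from p c)).
{ rewrite <- (Cmod_opp (from p a - from p c)), <- !Cmod_mult; f_equal.
  transitivity (from p a * from p c - from p b * from p c)%C; [ring | rewrite <- E; ring]. }
right; left; apply sim_ord_swap, (sim_ord_from (k * Cmod (from p a)) p).
- apply Rmult_lt_0_compat; trivial; now apply Cmod_gt_0.
- rewrite E3, !Rmult_assoc; f_equal; exact Ec.
- rewrite E1, (Cmod_sub_sym (from p c)); ring.
- rewrite E2, !Rmult_assoc; f_equal; exact Eb.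
Qed.

(** The terms with conj(a) cancel in [csd a b * c - csd c a * b], leaving [a * csk b c]. *)
Lemma orthocenter_csk (a b c : C) :
  csd a b = csd b c -> csd c a = csd b c -> (a * csk b c = csd b c * (c - b))%C.
Proof.
intros H1 H2.
transitivity (csd a b * c - csd c a * b)%C; [unfold csd, csk; ring |].
rewrite H1, H2; ring.
Qed.

Lemma orthocenter_step2 (nu nu' : C) (p a b c x y z x' y' z' : point) :
  admissible (from p a) (from p b) (from p c) ->
  admissible (from p x) (from p y) (from p z) ->
  feet nu (from p a) (from p b) (from p c) (from p x) (from p y) (from p z) ->
  feet nu' (from p x) (from p y) (from p z) (from p x') (from p y') (from p z') ->
  orthocenter p a b c -> similar a b c x' y' z'.
Proof.
intros Ha Hx F F' [O1 O2].
destruct (feet2_lengths _ _ _ _ _ _ _ _ _ _ _ Ha Hx F F') as [k [Hk [E1 [E2 E3]]]].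
assert (H1 : csd (from p a) (from p b) = csd (from p b) (from p c)).
{ rewrite !csd_dot; f_equal; unfold dot, from, vsub, px, py in *; simpl in *; lra. }
assert (H2 : csd (from p c) (from p a) = csd (from p b) (from p c)).
{ rewrite !csd_dot; f_equal; unfold dot, from, vsub, px, py in *; simpl in *; lra. }
assert (H3 : csd (from p a) (from p b) = csd (from p c) (from p a)) by congruence.
assert (Ka := f_equal Cmod (orthocenter_csk _ _ _ H1 H2)).
assert (Kb := f_equal Cmod (orthocenter_csk _ _ _ (eq_sym H2) H3)).
assert (Kc := f_equal Cmod (orthocenter_csk _ _ _ (eq_sym H3) (eq_sym H1))).
rewrite H2 in Kb; rewrite H1 in Kc.
rewrite !Cmod_mult in *; rewrite Ka in E1; rewrite Kb in E2; rewrite Kc in E3.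
left; apply (sim_ord_from (k * Cmod (csd (from p b) (from p c))) p).
(* The scale factor does not vanish: otherwise [Ka] would give a = 0 or [csk b c] = 0. *)
- apply Rmult_lt_0_compat; trivial; apply Cmod_gt_0; intros E.
  rewrite E, Cmod_0, Rmult_0_l in Ka.
  apply Rmult_integral in Ka; destruct Ka as [Ka | Ka]; apply Cmod_eq_0 in Ka; revert Ka.
  + apply admissible_neq0 in Ha; tauto.
  + apply Ha.
- rewrite E3, (Cmod_sub_sym (from p b)); ring.
- rewrite E1, (Cmod_sub_sym (from p c)); ring.
- rewrite E2, (Cmod_sub_sym (from p a)); ring.
Qed.

(** Since [csd b c] is real, the hypothesis and its conjugate determine a = csd(b,c)/conj(b + c) and
    conj(a), and everything follows by substitution. In particular [a] is a real multiple of b + c,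
    so the origin is on the median from [a]. *)
Lemma M_csk (a b c : C) :
  (Cconj a * (b + c) = csd b c -> b + c <> 0 -> Cconj (b + c) <> 0 ->
   csk a b = - csd b c * csk b c / ((b + c) * Cconj (b + c)) /\
   csk c a = - csd b c * csk b c / ((b + c) * Cconj (b + c)) /\
   a - b = Cconj b * (c - b) / Cconj (b + c) /\
   c - a = Cconj c * (c - b) / Cconj (b + c))%C.
Proof.
intros H Hq Hq'.
assert (H' : (a * Cconj (b + c) = csd b c)%C).
{ rewrite <- (csd_conj b c), <- H, Cmult_conj, Cconj_conj; reflexivity. }
assert (Ea : a = (csd b c / Cconj (b + c))%C) by (rewrite <- H'; field; trivial).
assert (Ea' : Cconj a = (csd b c / (b + c))%C) by (rewrite <- H; field; trivial).
assert (Eq : Cconj (b + c) = (Cconj b + Cconj c)%C) by apply Cplus_conj.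
repeat split.
- unfold csk at 1; rewrite Ea', Ea, Eq in *; unfold csk; field; auto.
- unfold csk at 1; rewrite Ea', Ea, Eq in *; unfold csk; field; auto.
- rewrite Ea, Eq in *; unfold csd; field; auto.
- rewrite Ea, Eq in *; unfold csd; field; auto.
Qed.

Lemma M_step2 (nu nu' : C) (p a b c x y z x' y' z' : point) :
  admissible (from p a) (from p b) (from p c) ->
  admissible (from p x) (from p y) (from p z) ->
  feet nu (from p a) (from p b) (from p c) (from p x) (from p y) (from p z) ->
  feet nu' (from p x) (from p y) (from p z) (from p x') (from p y') (from p z') ->
  (Cconj (from p a) * (from p b + from p c) = csd (from p b) (from p c))%C ->
  similar a b c x' y' z'.
Proof.
intros Ha Hx F F' H.
destruct (feet2_lengths _ _ _ _ _ _ _ _ _ _ _ Ha Hx F F') as [k [Hk [E1 [E2 E3]]]].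
destruct (admissible_neq0 _ _ _ Ha) as [Na [Nb Nc]].
destruct Ha as [Kbc [_ [Kab _]]].
right; left.
set (u := from p a) in *; set (v := from p b) in *; set (w := from p c) in *.
assert (Hq : (v + w <> 0)%C).
(* If b + c = 0, then [b] and [c] are opposite and the origin lies on their line. *)
{ intros E.
  rewrite E, Cmult_0_r in H.
  assert (Ew : w = (- v)%C) by (transitivity (v + w - v)%C; [ring | rewrite E; ring]).
  apply Kbc; rewrite Ew; unfold csk; rewrite Copp_conj; ring. }
assert (Hh : csd v w <> 0%C).
{ intros E; rewrite E in H.
  apply Cmult_neq_0 in H; trivial; now apply Cconj_neq0. }
pose proof (Cconj_neq0 _ Hq) as Hq'.
destruct (M_csk _ _ _ H Hq Hq') as [M1 [M2 [M3 M4]]].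
assert (Mu : Cmod u * Cmod (v + w) = Cmod (csd v w)).
{ rewrite <- H, Cmod_mult, Cmod_conj; reflexivity. }
destruct (csk_diff _ _ Kbc) as [Kd _].
apply Cmod_gt_0 in Hq as Pq; apply Cmod_gt_0 in Hh; apply Cmod_gt_0 in Kbc; apply Cmod_gt_0 in Kd.
apply sim_ord_swap,
  (* By [M_csk], |b| |csk c a| and |c| |csk a b| are this ratio times |a - b| and |c - a|, and |a|
     |csk b c| is the same ratio times |b - c|. So x'y'z' corresponds to acb. *)
  (sim_ord_from (k * (Cmod (csd v w) * Cmod (csk v w) / (Cmod (v + w) * Cmod (w - v)))) p);
  fold u v w.
- apply Rmult_lt_0_compat; trivial.
  apply Rdiv_lt_0_compat; now apply Rmult_lt_0_compat.
- rewrite E3, M1, (Cmod_sub_sym u w), M4.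
  rewrite !Cmod_div, !Cmod_mult, !Cmod_conj, Cmod_opp by (trivial; now apply Cmult_neq_0).
  field; lra.
- rewrite E1, <- Mu; field; lra.
- rewrite E2, M2, (Cmod_sub_sym v u), M3.
  rewrite !Cmod_div, !Cmod_mult, !Cmod_conj, Cmod_opp by (trivial; now apply Cmult_neq_0).
  field; lra.
Qed.

(** * The complex equation of the points M *)

(** With e the midpoint of bc, the condition on [t] is the signed relation EM·EA = EB². For v = e -
    a and w = (c - b)/2 it reads |w|² = (1 - t)|v|², which is the real part of the claim; the
    imaginary part vanishes on the median. *)
Lemma M_of_param (a b c m : point) (t : R) :
  m = vadd a (vscale t (vsub (midpoint b c) a)) ->
  dot (vsub c b) (vsub c b) / 4
  = (1 - t) * dot (vsub (midpoint b c) a) (vsub (midpoint b c) a) ->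
  (Cconj (from m a) * (from m b + from m c) = csd (from m b) (from m c))%C.
Proof.
intros -> H.
destruct a as [a1 a2], b as [b1 b2], c as [c1 c2].
unfold csd, from, midpoint, dot, vsub, vadd, vscale, px, py in *; simpl in *.
assert (Eb : exists v w, b1 = a1 + v - w /\ c1 = a1 + v + w).
{ exists ((b1 + c1) / 2 - a1), ((c1 - b1) / 2); split; lra. }
assert (Ec : exists v w, b2 = a2 + v - w /\ c2 = a2 + v + w).
{ exists ((b2 + c2) / 2 - a2), ((c2 - b2) / 2); split; lra. }
destruct Eb as [v1 [w1 [-> ->]]], Ec as [v2 [w2 [-> ->]]].
assert (K : w1 * w1 + w2 * w2 = (1 - t) * (v1 * v1 + v2 * v2)) by lra.
apply injective_projections; simpl.
- apply Rminus_diag_uniq.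
  transitivity (2 * (w1 * w1 + w2 * w2 - (1 - t) * (v1 * v1 + v2 * v2))); [field |].
  rewrite K; ring.
- field.
Qed.

(* the power of the midpoint of bc with respect to the circle *)
Lemma chord_power (a b c : point) (r s : R) :
  nondeg a b c -> r <> s ->
  on_circle3 (vadd a (vscale r (vsub (midpoint b c) a)))
             (vadd a (vscale s (vsub (midpoint b c) a))) b c ->
  dot (vsub c b) (vsub c b) / 4
  = (1 - r) * (s - 1) * dot (vsub (midpoint b c) a) (vsub (midpoint b c) a).
Proof.
intros Hn Hrs Hc; apply concyclic_det in Hc.
(* The concyclicity determinant is this factor times the difference of the two sides. *)
apply Rminus_diag_uniq, (Rmult_eq_reg_l ((r - s) * orient a b c)).
2: apply Rmult_integral_contrapositive; split; [lra | exact Hn].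
rewrite Rmult_0_r, <- Hc.
unfold orient, midpoint, cross, dot, vsub, vadd, vscale, px, py; simpl; field.
Qed.

Lemma is_M_rel (a b c m : point) :
  nondeg a b c -> is_M a b c m ->
  (Cconj (from m a) * (from m b + from m c) = csd (from m b) (from m c))%C.
Proof.
intros Hn HM.
assert (Hae : a <> midpoint b c).
{ intros ->; apply Hn; unfold collinear, orient, cross, midpoint, vadd, vscale, vsub, px, py;
    simpl; field. }
assert (Hbc : 0 < dot (vsub c b) (vsub c b)).
{ destruct (Rle_lt_or_eq_dec _ _ (dot_self_ge0 (vsub c b))) as [L | E]; trivial.
  exfalso; apply Hn; apply eq_sym, Rplus_sqr_eq_0 in E.
  unfold collinear, orient, cross, vsub, px, py in *; simpl in *; nra. }
destruct HM as [[_ [f [Hf [Hfa [Hc [[t [Ht ->]] Hd]]]]]] | [_ [Hm [Hmf Hc]]]].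
- destruct (on_line_param f a _ Hae Hf) as [q ->].
  assert (Hq : q <> 0).
  { intros ->; apply Hfa; unfold vadd, vscale, vsub, px, py; apply injective_projections; simpl; ring. }
  (* Acute case: the chord through e ends at [a] (parameter 0) and [f] (parameter [q]). *)
  assert (E : dot (vsub c b) (vsub c b) / 4
    = (1 - q) * (0 - 1) * dot (vsub (midpoint b c) a) (vsub (midpoint b c) a)).
  { apply chord_power; trivial.
    replace (vadd a (vscale 0 _)) with a; trivial.
    unfold vadd, vscale, vsub, px, py; apply injective_projections; simpl; ring. }
  apply (M_of_param _ _ _ _ t); trivial; rewrite E; clear Hc.
  apply dist_eq_sq in Hd.
  revert Hd E.
  replace (dot (vsub (midpoint b c) (vadd a (vscale t (vsub (midpoint b c) a)))) _)
    with ((1 - t) * (1 - t) * dot (vsub (midpoint b c) a) (vsub (midpoint b c) a)).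
  2: unfold dot, vsub, vadd, vscale, px, py; simpl; ring.
  replace (dot (vsub (midpoint b c) (vadd a (vscale q (vsub (midpoint b c) a)))) _)
    with ((1 - q) * (1 - q) * dot (vsub (midpoint b c) a) (vsub (midpoint b c) a)).
  2: unfold dot, vsub, vadd, vscale, px, py; simpl; ring.
  pose proof (dot_self_ge0 (vsub (midpoint b c) a)) as HV.
  generalize dependent (dot (vsub (midpoint b c) a) (vsub (midpoint b c) a)); intros V HV Hd E.
  assert (HV' : 0 < V) by nra.
  (* So [f] lies beyond the midpoint, while [t] is at most 1; equal distances from e then mean 1 - t
     = q - 1. *)
  assert (Hq1 : 1 < q) by nra.
  apply Rmult_eq_reg_r in Hd; [| lra].
  f_equal; nra.
- destruct (on_line_param m a _ Hae Hm) as [t ->].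
  (* Obtuse case: the fourth vertex of the parallelogram has parameter 2 on the median. *)
  assert (Ef : vsub (vadd b c) a = vadd a (vscale 2 (vsub (midpoint b c) a))).
  { unfold midpoint, vadd, vscale, vsub, px, py; apply injective_projections; simpl; field. }
  rewrite Ef in *.
  apply (M_of_param _ _ _ _ t); trivial.
  rewrite (chord_power a b c t 2); trivial; [ring |].
  intros ->; apply Hmf; reflexivity.
Qed.

(** * The symmedian and the complex equation of the points S *)

(** Put u = b - a and v = c - a. Reflection in the bisector sends u to (|u|/|v|) v and v to
    (|v|/|u|) u, so (u + v)/2 goes to (|v|² u + |u|² v)/(2|u||v|). *)
Lemma symmedian_dirE (a b c : point) :
  nondeg a b c ->
  exists k, symmedian_dir a b c
    = vscale k (vadd (vscale (dot (vsub c a) (vsub c a)) (vsub b a))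
                     (vscale (dot (vsub b a) (vsub b a)) (vsub c a))).
Proof.
intros Hn.
unfold symmedian_dir.
replace (vsub (midpoint b c) a) with (vscale (1/2) (vadd (vsub b a) (vsub c a))).
2: unfold midpoint, vadd, vscale, vsub, px, py; apply injective_projections; simpl; field.
rewrite (dist_sym a b), (dist_sym a c); unfold dist, norm.
pose proof (dot_self_ge0 (vsub b a)) as Gb; pose proof (dot_self_ge0 (vsub c a)) as Gc.
pose proof (sqrt_sqrt _ Gb) as Sb; pose proof (sqrt_sqrt _ Gc) as Sc.
pose proof (sqrt_pos (dot (vsub b a) (vsub b a))) as Pb.
pose proof (sqrt_pos (dot (vsub c a) (vsub c a))) as Pc.
revert Sb Sc Pb Pc.
generalize (sqrt (dot (vsub b a) (vsub b a))) (sqrt (dot (vsub c a) (vsub c a))).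
assert (Hx : cross (vsub b a) (vsub c a) <> 0) by exact Hn; revert Hx; clear.
generalize (vsub b a) (vsub c a); clear; intros u v Hx be ga Sb Sc Pb Pc.
assert (L : dot u v * dot u v + cross u v * cross u v = dot u u * dot v v)
  by (unfold dot, cross; ring).
assert (Qx : 0 < cross u v * cross u v) by nra.
rewrite <- Sb, <- Sc in L.
assert (Hb : 0 < be) by (destruct Pb as [Pb | <-]; trivial; nra).
assert (Hc : 0 < ga) by (destruct Pc as [Pc | <-]; trivial; nra).
(* The unit vectors along the two sides are not opposite, so the bisector vector [w] is nonzero. *)
assert (Hg : 0 < be * ga + dot u v).
{ apply Rnot_le_lt; intros Hle.
  assert (0 <= (- dot u v - be * ga) * (be * ga - dot u v))
    by (apply Rmult_le_pos; nra).
  nra. }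
set (w := vadd (vscale (/ be) u) (vscale (/ ga) v)).
assert (E1 : dot (vscale (1/2) (vadd u v)) w
             = (be + ga) * (be * ga + dot u v) / (2 * be * ga)).
{ transitivity ((dot u u / be + dot u v / be + dot u v / ga + dot v v / ga) / 2).
  - unfold w, dot, vadd, vscale, px, py; simpl; field; lra.
  - rewrite <- Sb, <- Sc; field; lra. }
assert (E2 : dot w w = 2 * (be * ga + dot u v) / (be * ga)).
{ transitivity (dot u u / (be * be) + 2 * dot u v / (be * ga) + dot v v / (ga * ga)).
  - unfold w, dot, vadd, vscale, px, py; simpl; field; lra.
  - rewrite <- Sb, <- Sc; field; lra. }
rewrite E1, E2, <- Sb, <- Sc.
exists (/ (2 * be * ga)).
unfold w, vadd, vsub, vscale, px, py; apply injective_projections; simpl; field; lra.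
Qed.

(* With a at the origin, the symmedian meets the circle bco where 2 g r = 1 (the pole of bc, which
   bc separates from o) and where N r = 1. *)
Lemma symmedian_circle (b1 b2 c1 c2 x y r : R) :
  let D := b1 * c2 - b2 * c1 in
  let g := b1 * c1 + b2 * c2 in
  let bb := b1 * b1 + b2 * b2 in
  let cc := c1 * c1 + c2 * c2 in
  let N := (b1 + c1) * (b1 + c1) + (b2 + c2) * (b2 + c2) in
  let s : point := (r * (cc * b1 + bb * c1), r * (cc * b2 + bb * c2)) in
  D <> 0 -> 2 * (x * b1 + y * b2) = bb -> 2 * (x * c1 + y * c2) = cc ->
  on_circle3 s (b1, b2) (c1, c2) (x, y) ->
  0 < orient (b1, b2) (c1, c2) s * orient (b1, b2) (c1, c2) (x, y) ->
  N * r = 1.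
Proof.
intros D g bb cc N s HD Hb Hc Hs Ho.
assert (Ex : x = (bb * c2 - cc * b2) / (2 * D)).
{ apply (Rmult_eq_reg_l (2 * D)); [| lra].
  transitivity (bb * c2 - cc * b2); [rewrite <- Hb, <- Hc; unfold D; ring | field; trivial]. }
assert (Ey : y = (cc * b1 - bb * c1) / (2 * D)).
{ apply (Rmult_eq_reg_l (2 * D)); [| lra].
  transitivity (cc * b1 - bb * c1); [rewrite <- Hb, <- Hc; unfold D; ring | field; trivial]. }
apply concyclic_det in Hs.
set (dd := (c1 - b1) * (c1 - b1) + (c2 - b2) * (c2 - b2)).
(* Times -4 D, the concyclicity determinant splits into two factors linear in [r], one for each
   intersection of the symmedian with the circle. *)
assert (E1 : bb * cc * dd * ((2 * g * r - 1) * (N * r - 1)) = 0).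
{ transitivity (- 4 * D * 0); [| ring].
  rewrite <- Hs; unfold s, dot, cross, vsub, px, py; simpl; rewrite Ex, Ey.
  unfold dd, N, g, bb, cc, D in *; field; trivial. }
assert (E2 : orient (b1, b2) (c1, c2) s * orient (b1, b2) (c1, c2) (x, y)
             = (1 - r * (bb + cc)) * g * dd / 2).
{ unfold s, orient, cross, vsub, px, py; simpl; rewrite Ex, Ey.
  unfold dd, g, bb, cc, D in *; field; trivial. }
rewrite E2 in Ho.
assert (Ed : dd = bb + cc - 2 * g) by (unfold dd, bb, cc, g; ring).
assert (Pos : forall u v, ~ (u = 0 /\ v = 0) -> u * u + v * v <> 0).
{ intros u v H E; now apply H, Rplus_sqr_eq_0. }
assert (Hbb : bb <> 0).
{ apply Pos; intros [H1 H2]; apply HD; unfold D; rewrite H1, H2; ring. }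
assert (Hcc : cc <> 0).
{ apply Pos; intros [H1 H2]; apply HD; unfold D; rewrite H1, H2; ring. }
assert (Hdd : dd <> 0) by (intros E; rewrite E in Ho; lra).
apply Rmult_integral in E1; destruct E1 as [E1 | E1].
- exfalso; revert E1; repeat apply Rmult_integral_contrapositive_currified; assumption.
- apply Rmult_integral in E1; destruct E1 as [E1 | E1]; [exfalso | lra].
  assert (E3 : (1 - r * (bb + cc)) * g * dd / 2 = - (dd * dd / 4)).
  { replace ((1 - r * (bb + cc)) * g * dd / 2)
      with ((g - (2 * g * r) / 2 * (bb + cc)) * dd / 2) by field.
    replace (2 * g * r) with 1 by lra; rewrite Ed; field. }
  rewrite E3 in Ho; nra.
Qed.

Lemma on_circle3_sub (a x u v w : point) :
  on_circle3 x u v w -> on_circle3 (vsub x a) (vsub u a) (vsub v a) (vsub w a).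
Proof.
assert (D : forall p q, dist (vsub p a) (vsub q a) = dist p q).
{ intros p q; unfold dist, norm, dot, vsub, px, py; simpl; f_equal; ring. }
intros [Hn [o Ho]]; split.
- intros E; apply Hn; unfold collinear in *; rewrite <- E.
  unfold orient, cross, vsub, px, py; simpl; ring.
- exists (vsub o a); rewrite !D; exact Ho.
Qed.

(** With [a] at the origin the equation becomes s(b + c) = bc, that is, s = (|c|² b + |b|² c)/|b +
    c|². This is the point of the symmedian singled out by [symmedian_circle]. *)
Lemma is_S_rel (a b c s : point) :
  nondeg a b c -> is_S a b c s ->
  (from s a * from s a = from s b * from s c)%C.
Proof.
intros Hn [o [[O1 O2] [[t [_ ->]] [Hc Ho]]]].
destruct (symmedian_dirE a b c Hn) as [k Ek]; rewrite Ek in *; clear Ek.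
apply (on_circle3_sub a) in Hc.
apply dist_eq_sq in O1, O2.
assert (T : forall u, orient (vsub b a) (vsub c a) (vsub u a) = orient b c u).
{ intros u; unfold orient, cross, vsub, px, py; simpl; ring. }
rewrite <- !T in Ho; clear T.
assert (Hn' : cross (vsub b a) (vsub c a) <> 0) by exact Hn.
destruct a as [a1 a2], b as [b1 b2], c as [c1 c2], o as [o1 o2].
assert (E := fun H => symmedian_circle (b1 - a1) (b2 - a2) (c1 - a1) (c2 - a2)
  (o1 - a1) (o2 - a2) (t * k) Hn' H).
unfold from, dot, vsub, vadd, vscale, px, py in *; simpl in *.
match type of Hc with on_circle3 ?u _ _ _ =>
match type of E with context [on_circle3 ?v _ _ _] =>
  replace u with v in * by (f_equal; ring) end end.
assert (H1 : 2 * ((o1 - a1) * (b1 - a1) + (o2 - a2) * (b2 - a2))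
             = (b1 - a1) * (b1 - a1) + (b2 - a2) * (b2 - a2)) by lra.
assert (H2 : 2 * ((o1 - a1) * (c1 - a1) + (o2 - a2) * (c2 - a2))
             = (c1 - a1) * (c1 - a1) + (c2 - a2) * (c2 - a2)) by lra.
specialize (E H1 H2 Hc Ho); clear - E.
(* The two sides differ by (N r - 1) b c, with [a] as origin; its real and imaginary parts are
   treated in turn. *)
apply injective_projections; simpl; apply Rminus_diag_uniq.
- match type of E with ?l = 1 => transitivity
    ((l - 1) * ((b1 - a1) * (c1 - a1) - (b2 - a2) * (c2 - a2))); [ring | rewrite E; ring] end.
- match type of E with ?l = 1 => transitivity
    ((l - 1) * ((b1 - a1) * (c2 - a2) + (b2 - a2) * (c1 - a1))); [ring | rewrite E; ring] end.
Qed.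

(** * Chains of Miquel triangles *)

Lemma first_brocard_step (p a b c x y z : point) :
  ~ on_line p b c -> ~ on_line p c a -> ~ on_line p a b ->
  miquel a b c x y z p -> first_brocard p a b c ->
  first_brocard p x y z /\ sim_ord b c a x y z.
Proof.
intros Hbc Hca Hab HM HB.
destruct (miquel_feet _ _ _ _ _ _ _ Hbc Hca Hab HM) as [nu F].
destruct (first_brocard_feet _ _ _ _ Hbc Hca Hab HB) as [nu' F'].
destruct (feet_proportional _ _ _ _ _ _ _ _ _ _ _ F' F) as [mu [Hmu [E1 [E2 E3]]]].
split.
- now apply (first_brocard_spiral p mu b c a), first_brocard_rot.
- now apply (sim_ord_spiral p mu).
Qed.

Lemma first_brocard_chain (A B C : nat -> point) (P : point) :
  (forall k : nat, ~ on_line P (B k) (C k) /\ ~ on_line P (C k) (A k) /\ ~ on_line P (A k) (B k)) ->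
  (forall k : nat, miquel (A k) (B k) (C k) (A (S k)) (B (S k)) (C (S k)) P) ->
  first_brocard P (A 0%nat) (B 0%nat) (C 0%nat) ->
  forall k : nat, first_brocard P (A k) (B k) (C k) /\
    similar (A 0%nat) (B 0%nat) (C 0%nat) (A k) (B k) (C k).
Proof.
intros Hn Hm H0 k; induction k as [| k [IB IS]].
- split; [exact H0 | left; apply sim_ord_refl].
- destruct (Hn k) as [H1 [H2 H3]].
  destruct (first_brocard_step _ _ _ _ _ _ _ H1 H2 H3 (Hm k) IB) as [SB SS].
  split; [exact SB |].
  (* A step matches b, c, a with x, y, z, so the labels are rotated before composing. *)
  apply similar_rot_r in IS.
  exact (similar_trans_sim_ord _ _ _ _ _ _ _ _ _ IS SS).
Qed.

Theorem theorem15 (A B C : nat -> point) (P : point) :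
  (forall k : nat,
     nondeg (A k) (B k) (C k) /\
     ~ on_line P (B k) (C k) /\ ~ on_line P (C k) (A k) /\ ~ on_line P (A k) (B k)) ->
  (forall k : nat,
     miquel (A k) (B k) (C k) (A (S k)) (B (S k)) (C (S k)) P) ->
  ((first_brocard P (A 0%nat) (B 0%nat) (C 0%nat) ->
      forall k : nat, first_brocard P (A k) (B k) (C k) /\
        ((1 <= k)%nat -> similar (A 0%nat) (B 0%nat) (C 0%nat) (A k) (B k) (C k))) /\
   (second_brocard P (A 0%nat) (B 0%nat) (C 0%nat) ->
      forall k : nat, second_brocard P (A k) (B k) (C k) /\
        ((1 <= k)%nat -> similar (A 0%nat) (B 0%nat) (C 0%nat) (A k) (B k) (C k))) /\
   ((circumcenter P (A 0%nat) (B 0%nat) (C 0%nat) \/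
     is_S (A 0%nat) (B 0%nat) (C 0%nat) P \/
     is_S (B 0%nat) (C 0%nat) (A 0%nat) P \/
     is_S (C 0%nat) (A 0%nat) (B 0%nat) P) ->
      forall k : nat, (k mod 3 = 0 \/ k mod 3 = 1)%nat ->
        similar (A 0%nat) (B 0%nat) (C 0%nat) (A k) (B k) (C k)) /\
   ((orthocenter P (A 0%nat) (B 0%nat) (C 0%nat) \/
     is_M (A 0%nat) (B 0%nat) (C 0%nat) P \/
     is_M (B 0%nat) (C 0%nat) (A 0%nat) P \/
     is_M (C 0%nat) (A 0%nat) (B 0%nat) P) ->
      forall k : nat, (k mod 3 = 2 \/ k mod 3 = 0)%nat ->
        similar (A 0%nat) (B 0%nat) (C 0%nat) (A k) (B k) (C k))).
Proof.
intros Hn Hm.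
assert (Ad : forall k, admissible (from P (A k)) (from P (B k)) (from P (C k))).
{ intros k; destruct (Hn k) as [H0 [H1 [H2 H3]]]; now apply admissible_from. }
assert (F : forall k, exists nu, feet nu (from P (A k)) (from P (B k)) (from P (C k))
              (from P (A (S k))) (from P (B (S k))) (from P (C (S k)))).
{ intros k; destruct (Hn k) as [_ [H1 [H2 H3]]]; now apply miquel_feet. }
assert (Per : forall k,
  sim_ord (A k) (B k) (C k) (A (S (S (S k)))) (B (S (S (S k)))) (C (S (S (S k))))).
{ intros k; destruct (F k) as [n0 F0], (F (S k)) as [n1 F1], (F (S (S k))) as [n2 F2].
  destruct (three_feet_spiral _ _ _ _ _ _ _ _ _ _ _ _ _ _ _
              (Ad _) (Ad _) (Ad _) (Ad _) F0 F1 F2) as [mu [Hmu [E1 [E2 E3]]]].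
  now apply (sim_ord_spiral P mu). }
assert (Mod : forall k, similar (A 0%nat) (B 0%nat) (C 0%nat)
                          (A (k mod 3)%nat) (B (k mod 3)%nat) (C (k mod 3)%nat) ->
                        similar (A 0%nat) (B 0%nat) (C 0%nat) (A k) (B k) (C k)).
(* Only the indices in the conclusion are split as 3 j + r; induction on the quotient j adds one
   period of three steps at a time. *)
{ intros k; rewrite (Nat.div_mod_eq k 3) at 4 5 6.
  generalize (k mod 3)%nat (k / 3)%nat; intros r j H.
  induction j as [| j IH]; [exact H |].
  replace (3 * S j + r)%nat with (S (S (S (3 * j + r)))) by ring.
  exact (similar_trans_sim_ord _ _ _ _ _ _ _ _ _ IH (Per _)). }
assert (N0 : nondeg (A 0%nat) (B 0%nat) (C 0%nat)) by apply Hn.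
assert (N : nondeg (B 0%nat) (C 0%nat) (A 0%nat) /\ nondeg (C 0%nat) (A 0%nat) (B 0%nat)).
{ split; intros E; apply N0; unfold collinear in *; rewrite <- E;
    unfold orient, cross, vsub, px, py; simpl; ring. }
destruct N as [N1 N2].
split; [| split; [| split]].
- intros H k.
  destruct (first_brocard_chain A B C P (fun k => proj2 (Hn k)) Hm H k); auto.
- intros H k; apply second_brocard_swap in H.
  (* The chain with [B] and [C] exchanged is again a Miquel chain, with [P] as first Brocard
     point. *)
  destruct (first_brocard_chain A C B P) with (k := k) as [HB HS]; trivial.
  + intros i; destruct (Hn i) as [_ [H1 [H2 H3]]].
    split; [| split]; intros E; apply on_line_sym in E; auto.
  + intros i; apply miquel_swap, Hm.
  + split; [now apply second_brocard_swap | intros _; now apply similar_swap].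
- intros H k Hk; apply Mod.
  destruct Hk as [-> | ->]; [left; apply sim_ord_refl |].
  destruct (F 0%nat) as [nu F0].
  pose proof (Ad 0%nat) as A0; pose proof (admissible_rot _ _ _ A0) as A1.
  destruct H as [H | [H | [H | H]]].
  + exact (circumcenter_step _ _ _ _ _ _ _ _ A0 F0 H).
  + exact (S_step _ _ _ _ _ _ _ _ A0 F0 (is_S_rel _ _ _ _ N0 H)).
  (* The cyclically relabeled triangles satisfy the same hypotheses; the rotations bring the goal to
     that labeling. *)
  + apply similar_rot_l; do 2 apply similar_rot_r.
    exact (S_step _ _ _ _ _ _ _ _ A1 (feet_rot _ _ _ _ _ _ _ F0) (is_S_rel _ _ _ _ N1 H)).
  + do 2 apply similar_rot_l; apply similar_rot_r.
    exact (S_step _ _ _ _ _ _ _ _ (admissible_rot _ _ _ A1)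
             (feet_rot _ _ _ _ _ _ _ (feet_rot _ _ _ _ _ _ _ F0)) (is_S_rel _ _ _ _ N2 H)).
- intros H k Hk; apply Mod.
  destruct Hk as [-> | ->]; [| left; apply sim_ord_refl].
  destruct (F 0%nat) as [nu F0], (F 1%nat) as [nu' F1].
  pose proof (Ad 0%nat) as A0; pose proof (admissible_rot _ _ _ A0) as A1.
  pose proof (Ad 1%nat) as B0; pose proof (admissible_rot _ _ _ B0) as B1.
  destruct H as [H | [H | [H | H]]].
  + exact (orthocenter_step2 _ _ _ _ _ _ _ _ _ _ _ _ A0 B0 F0 F1 H).
  + exact (M_step2 _ _ _ _ _ _ _ _ _ _ _ _ A0 B0 F0 F1 (is_M_rel _ _ _ _ N0 H)).
  + apply feet_rot in F0, F1.
    apply similar_rot_l; do 2 apply similar_rot_r.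
    exact (M_step2 _ _ _ _ _ _ _ _ _ _ _ _ A1 B1 F0 F1 (is_M_rel _ _ _ _ N1 H)).
  + apply feet_rot in F0, F1; apply feet_rot in F0, F1.
    apply admissible_rot in A1, B1.
    do 2 apply similar_rot_l; apply similar_rot_r.
    exact (M_step2 _ _ _ _ _ _ _ _ _ _ _ _ A1 B1 F0 F1 (is_M_rel _ _ _ _ N2 H)).
Qed.
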